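(* Let $X$ be a topological space that is path-connected, locally path-connected and semi-locally simply connected, and let $x_0\in X$. Let $\Pi(X,x_0)=P(X,x_0)/\!\sim$ be the set of path-homotopy classes of continuous paths in $X$ starting at $x_0$, endowed with the quotient topology of the compact-open topology on $P(X,x_0)$. Then the map $p\colon \Pi(X,x_0)\to X$, $p([\alpha]):=\alpha(1)$, is the universal covering of $X$.
   Context: Let $I=[0,1]$. For a topological space $X$ and $x_0\in X$, $P(X,x_0)$ denotes the space of all continuous paths $\alpha\colon I\to X$ with $\alpha(0)=x_0$, endowed with the compact-open topology, i.e. the topology generated by the sub-basic sets $(A,V)=\{\alpha\in P(X,x_0)\mid \alpha(A)\subset V\}$ with $A\subseteq I$ compact and $V\subseteq X$ open. Two paths $\alpha,\alpha'$ in $X$ are path-homotopic, written $\alpha\sim\alpha'$, if they are homotopic relative to $\partial I=\{0,1\}$ (in particular they have the same endpoints). The (topological) fundamental groupoid of $X$ based at $x_0$ is the quotient topological space $\Pi(X,x_0):=P(X,x_0)/\!\sim$, with quotient map $q\colon P(X,x_0)\to\Pi(X,x_0)$, $q(\alpha)=[\alpha]$. The evaluation map $\alpha\mapsto\alpha(1)$ on $P(X,x_0)$ is continuous and constant on $\sim$-classes, so it induces the well-defined continuous map $p\colon\Pi(X,x_0)\to X$, $p([\alpha])=\alpha(1)$. A subset $U\subseteq X$ is an slsc-subset of $X$ if every loop in $U$ can be contracted to a point in $X$ (equivalently, every two paths in $U$ with common endpoints are path-homotopic in $X$; equivalently, the inclusion induces the trivial homomorphism $\pi_1(U,x)\to\pi_1(X,x)$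 for every $x\in U$). $X$ is semi-locally simply connected if it can be covered by open slsc-subsets. Covering and universal covering are understood in the standard sense (as in Spanier's Algebraic Topology): a covering $p\colon \widetilde X\to X$ is a continuous map such that every point of $X$ has an open neighbourhood $U$ for which $p^{-1}(U)$ is a disjoint union of open subsets each mapped homeomorphically onto $U$ by $p$; a covering $p\colon\widetilde X\to X$ with $\widetilde X$ connected is universal if for every covering $r\colon Y\to X$ with $Y$ connected there is a continuous map $f\colon\widetilde X\to Y$ with $r\circ f=p$. *)

(* Defs.v *)
From HB Require Import structures.
From mathcomp Require Import all_boot all_order all_algebra generic_quotient.
From mathcomp Require Import all_classical all_reals all_analysis.
From mathcomp Require Import homotopy.

Set Implicit Arguments.
Unset Strict Implicit.
Unset Printing Implicit Defensive.

Import Order.TTheory GRing.Theory Num.Theory.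
Import numFieldNormedType.Exports.

Local Open Scope classical_set_scope.
Local Open Scope ring_scope.
Local Open Scope quotient_scope.

(* The unit interval as a space of its own (subspace topology of R), bipointed
   by its end points, so that [{path unitI R from x to y}] is the library's type
   of continuous paths parametrized by [0, 1]. *)
Definition unitI (R : realType) : Type := set_type [set` `[0%R : R, 1%R]].

Section unit_interval.
Variable R : realType.

HB.instance Definition _ := Topological.copy (unitI R)
  (set_type [set` `[0%R : R, 1%R]]).

Definition unitI_val (t : unitI R) : R := set_val t.

Fact unitI0_subproof : (0 : R) \in [set` `[0%R : R, 1%R]].
Proof. by rewrite inE /= in_itv /= lexx ler01. Qed.

Fact unitI1_subproof : (1 : R) \in [set` `[0%R : R, 1%R]].
Proof. by rewrite inE /= in_itv /= lexx ler01. Qed.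

Definition unitI0 : unitI R := exist _ (0 : R) unitI0_subproof.
Definition unitI1 : unitI R := exist _ (1 : R) unitI1_subproof.

Fact unitI01_neq : unitI0 != unitI1.
Proof.
by apply/eqP => /(congr1 unitI_val); apply/eqP; rewrite eq_sym; exact: oner_neq0.
Qed.

HB.instance Definition _ := isBiPointed.Build (unitI R) unitI01_neq.

Lemma unitI_val_continuous : continuous unitI_val.
Proof. exact: (@initial_continuous _ _ set_val). Qed.

Lemma unitI_val_inj : injective unitI_val.
Proof. exact: val_inj. Qed.

Lemma unitI_val_itv t : 0 <= unitI_val t <= 1.
Proof. by have := set_valP t; rewrite /= in_itv. Qed.

Fact clampI_subproof (x : R) :
  Num.max 0 (Num.min 1 x) \in [set` `[0%R : R, 1%R]].
Proof. by rewrite inE /= in_itv /= le_max lexx ge_max ler01 ge_min lexx. Qed.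

Definition clampI (x : R) : unitI R :=
  exist _ (Num.max 0 (Num.min 1 x)) (clampI_subproof x).

Lemma clampI_valE x : unitI_val (clampI x) = Num.max 0 (Num.min 1 x).
Proof. by []. Qed.

Lemma unitI_val0 : unitI_val zero = 0. Proof. by []. Qed.

Lemma unitI_val1 : unitI_val one = 1. Proof. by []. Qed.

Lemma clampI_continuous : continuous clampI.
Proof.
apply/continuousP => _ [A oA <-].
rewrite -comp_preimage.
have : continuous (fun x : R => Num.max 0 (Num.min 1 x)).
  move=> x; apply: (@continuous_max _ _ (cst 0)); first exact: cst_continuous.
  by apply: (@continuous_min _ _ (cst 1) id); [exact: cst_continuous|].
by move/continuousP; exact.
Qed.

Lemma clampI_val t : clampI (unitI_val t) = t.
Proof.
apply: unitI_val_inj; rewrite clampI_valE.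
by have /andP[t0 t1] := unitI_val_itv t; rewrite (min_idPr t1) (max_idPr t0).
Qed.

Lemma clampI_le0 x : x <= 0 -> clampI x = zero.
Proof.
move=> x0; apply: unitI_val_inj; rewrite clampI_valE.
by apply/max_idPl; rewrite ge_min x0 orbT.
Qed.

Lemma clampI_ge1 x : 1 <= x -> clampI x = one.
Proof.
move=> x1; apply: unitI_val_inj; rewrite clampI_valE.
by rewrite (min_idPl x1); apply/max_idPr.
Qed.

End unit_interval.

(* [a] and [b] are homotopic relative to {0, 1}. *)
Definition path_homotopic (R : realType) (X : topologicalType)
    (a b : unitI R -> X) : Prop :=
  exists H : unitI R * unitI R -> X,
    [/\ continuous H,
        forall s, H (s, zero) = a s,
        forall s, H (s, one) = b s &
        forall t, H (zero, t) = a zero /\ H (one, t) = a one].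

Section path_homotopic_theory.
Variables (R : realType) (X : topologicalType).
Implicit Types a b c : unitI R -> X.

Lemma continuous_reparam_snd (F : unitI R * unitI R -> X)
    (h : unitI R * unitI R -> unitI R) :
  continuous F -> continuous h -> continuous (fun p => F (p.1, h p)).
Proof.
move=> cF ch p; apply: (@continuous_comp _ _ _ (fun p => (p.1, h p)) F).
  apply: (@cvg_pair _ _ _ (nbhs p) (nbhs p.1) (nbhs (h p)) _ _ _ fst h).
    exact: cvg_fst.
  exact: ch.
exact: cF.
Qed.

Lemma path_homotopic_refl a : continuous a -> path_homotopic a a.
Proof.
move=> ca; exists (a \o fst); split => // x.
by apply: continuous_comp; [exact: cvg_fst|exact: ca].
Qed.

Lemma path_homotopic_endpoints a b :
  path_homotopic a b -> a zero = b zero /\ a one = b one.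
Proof. by case=> H [_ _ Hb Hr]; have [] := Hr one; rewrite !Hb. Qed.

Lemma path_homotopic_sym a b : path_homotopic a b -> path_homotopic b a.
Proof.
move=> ab; have [e0 e1] := path_homotopic_endpoints ab.
case: ab => H [cH Ha Hb Hr].
pose rv (t : unitI R) := clampI (1 - unitI_val t).
have crv : continuous rv.
  move=> t.
  apply: (@continuous_comp _ _ _ (fun t => 1 - unitI_val t) (@clampI R));
    last exact: clampI_continuous.
  by apply: continuousB; [exact: cst_continuous|exact: unitI_val_continuous].
exists (fun p => H (p.1, rv p.2)); split.
- apply: (continuous_reparam_snd cH (h := fun p => rv p.2)) => p.
  by apply: (@continuous_comp _ _ _ snd rv); [exact: cvg_snd|exact: crv].
- by move=> s /=; rewrite /rv clampI_ge1 ?Hb// unitI_val0 subr0.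
- by move=> s /=; rewrite /rv clampI_le0 ?Ha// unitI_val1 subrr.
- by move=> t /=; rewrite -e0 -e1; exact: Hr.
Qed.

Lemma path_homotopic_trans b a c :
  path_homotopic a b -> path_homotopic b c -> path_homotopic a c.
Proof.
move=> ab; have [e0 e1] := path_homotopic_endpoints ab.
case: ab => F [cF Fa Fb Fr] [G [cG Gb Gc Gr]].
pose v (p : unitI R * unitI R) : R := unitI_val p.2.
have cv : continuous v.
  move=> p; apply: (@continuous_comp _ _ _ snd (@unitI_val R)).
    exact: cvg_snd.
  exact: unitI_val_continuous.
pose F' p := F (p.1, clampI (v p + v p)).
pose G' p := G (p.1, clampI (v p + v p - 1)).
have cF' : continuous F'.
  apply: (continuous_reparam_snd cF (h := fun p => clampI (v p + v p))) => p.
  apply: (@continuous_comp _ _ _ (fun p => v p + v p) (@clampI R)).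
    by apply: continuousD; exact: cv.
  exact: clampI_continuous.
have cG' : continuous G'.
  apply: (continuous_reparam_snd cG (h := fun p => clampI (v p + v p - 1))) => p.
  apply: (@continuous_comp _ _ _ (fun p => v p + v p - 1) (@clampI R)).
    by apply: continuousB; [apply: continuousD; exact: cv|exact: cst_continuous].
  exact: clampI_continuous.
pose H p := if v p + v p <= 1 then F' p else G' p.
have HF p : v p + v p <= 1 -> H p = F' p by rewrite /H => ->.
have HG p : 1 <= v p + v p -> H p = G' p.
  rewrite le_eqVlt => /predU1P[e|lt1]; last by rewrite /H leNgt lt1.
  rewrite /H -e lexx /F' /G' -e subrr clampI_ge1// clampI_le0//.
  by rewrite Fb Gb.
pose A := [set p | v p + v p <= 1]; pose B := [set p | 1 <= v p + v p].
have cvv : continuous (fun p => v p + v p) by move=> p; apply: continuousD; exact: cv.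
have clA : closed A.
  by apply: (@closed_comp _ _ (fun p => v p + v p) [set x | x <= 1]) => //;
    exact: closed_le.
have clB : closed B.
  by apply: (@closed_comp _ _ (fun p => v p + v p) [set x | 1 <= x]) => //;
    exact: closed_ge.
exists H; split.
- have AB : A `|` B = setT.
    apply/seteqP; split => // p _.
    by case: (leP (v p + v p) 1) => h; [left|right; exact: ltW].
  apply/continuous_subspace_setT; rewrite -AB.
  apply: withinU_continuous => //.
  + apply: (subspace_eq_continuous (f := F' : subspace A -> X)).
      by move=> p /set_mem Ap; exact/esym/HF.
    exact: continuous_subspaceT.
  + apply: (subspace_eq_continuous (f := G' : subspace B -> X)).
      by move=> p /set_mem Bp; exact/esym/HG.
    exact: continuous_subspaceT.
- move=> s; have v0 : v (s, zero) = 0 by [].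
  rewrite HF ?v0 ?addr0 ?ler01// /F' v0 addr0 clampI_le0//.
- move=> s; have v1 : v (s, one) = 1 by [].
  by rewrite HG ?v1 ?lerDl ?ler01// /G' v1 addrK clampI_ge1.
- move=> t; case: (Gr (clampI (unitI_val t + unitI_val t - 1))) => g0 g1.
  case: (Fr (clampI (unitI_val t + unitI_val t))) => f0 f1.
  by rewrite /H /F' /G' /v /= f0 f1 g0 g1 e0 e1; case: ifP.
Qed.

End path_homotopic_theory.

Section fundamental_groupoid.
Variables (R : realType) (X : topologicalType) (x0 : X).

(* P(X, x0), with the topology induced by the compact-open topology. *)
Definition based_path : Type :=
  {a : continuousType (unitI R) X | a zero == x0}.

HB.instance Definition _ := Choice.copy based_path
  {a : continuousType (unitI R) X | a zero == x0}.

Definition based_path_fun (a : based_path) : unitI R -> X := \val a.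

HB.instance Definition _ := Topological.copy based_path
  (@initial_topology based_path {compact-open, unitI R -> X} based_path_fun).

Definition based_path_homotopic (a b : based_path) : bool :=
  `[< path_homotopic (based_path_fun a) (based_path_fun b) >].

Fact based_path_homotopic_refl : reflexive based_path_homotopic.
Proof. by move=> a; apply/asboolP/path_homotopic_refl; exact: cts_fun. Qed.

Fact based_path_homotopic_sym : symmetric based_path_homotopic.
Proof. by move=> a b; apply/asboolP/asboolP; exact: path_homotopic_sym. Qed.

Fact based_path_homotopic_trans : transitive based_path_homotopic.
Proof.
move=> b a c /asboolP ab /asboolP bc; apply/asboolP.
exact: path_homotopic_trans ab bc.
Qed.

Definition based_path_equiv := EquivRel based_path_homotopic
  based_path_homotopic_refl based_path_homotopic_sym based_path_homotopic_trans.

(* Pi(X, x0), with the quotient topology. *)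
Definition fundamental_groupoid : Type :=
  quotient_topology {eq_quot based_path_equiv}.

HB.instance Definition _ := Topological.copy fundamental_groupoid
  (quotient_topology {eq_quot based_path_equiv}).
HB.instance Definition _ := Quotient.copy fundamental_groupoid
  {eq_quot based_path_equiv}.

Definition endpoint (c : fundamental_groupoid) : X :=
  based_path_fun (repr c) one.

Lemma pi_eqP (a b : based_path) :
  \pi_fundamental_groupoid a = \pi_fundamental_groupoid b <->
  path_homotopic (based_path_fun a) (based_path_fun b).
Proof.
split=> [/eqmodP/asboolP//|ab].
by apply/eqmodP/asboolP.
Qed.

(* [endpoint] is the map [a] |-> a(1), whatever the representative. *)
Lemma endpoint_pi (a : based_path) :
  endpoint (\pi_fundamental_groupoid a) = based_path_fun a one.
Proof.
have := reprK (\pi_fundamental_groupoid a).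
by move/pi_eqP/path_homotopic_endpoints => [].
Qed.

End fundamental_groupoid.

Section connectivity.
Variables (R : realType) (X : topologicalType).

Definition path_connected (A : set X) : Prop :=
  forall x y, A x -> A y ->
    exists g : {path unitI R from x to y}, range g `<=` A.

Definition locally_path_connected : Prop :=
  forall (x : X) (U : set X), nbhs x U ->
    exists V : set X, [/\ open V, V x, V `<=` U & path_connected V].

Definition slsc_subset (U : set X) : Prop :=
  forall (x : X) (g : {path unitI R from x to x}),
    range g `<=` U -> path_homotopic (R := R) g (cst x).

Definition semilocally_simply_connected : Prop :=
  forall x : X, exists U : set X, [/\ open U, U x & slsc_subset U].

(* [connected set0] holds in the library, whereas connected spaces are nonempty
   here: otherwise the empty covering would rule out any universal covering of a
   nonempty space. *)
Definition connected_space : Prop :=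
  [set: X] !=set0 /\ connected [set: X].

End connectivity.

Definition homeomorphism (S T : topologicalType) (f : S -> T) : Prop :=
  continuous f /\
  exists g : T -> S, [/\ continuous g, cancel f g & cancel g f].

Section coverings.
Variables (E X : topologicalType) (p : E -> X).

(* [V] and [U] are seen as spaces in their own right, with the subspace
   topology; [f] is the restriction of [p]. *)
Definition maps_homeomorphically (V : set E) (U : set X) : Prop :=
  exists2 f : V -> U, homeomorphism f &
    forall v : V, set_val (f v) = p (set_val v).

Definition evenly_covered (U : set X) : Prop :=
  exists F : set (set E),
    [/\ forall V, F V -> open V,
        trivIset F id,
        p @^-1` U = \bigcup_(V in F) V &
        forall V, F V -> maps_homeomorphically V U].

Definition covering : Prop :=
  continuous p /\
  forall x : X, exists U : set X, [/\ open U, U x & evenly_covered U].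

End coverings.

Definition universal_covering (E X : topologicalType) (p : E -> X) : Prop :=
  [/\ covering p, connected_space E &
      forall (Y : topologicalType) (r : Y -> X),
        connected_space Y -> covering r ->
        exists f : E -> Y, continuous f /\ r \o f = p].

(* Main.v *)
From HB Require Import structures.
Require Import Defs.
From mathcomp Require Import all_boot all_order all_algebra.
From mathcomp Require Import all_classical all_reals all_analysis.
From mathcomp Require Import generic_quotient homotopy lra.

(** Two based paths whose end points lie in an open set V are called linked in V
    when some homotopy joins them that keeps the start fixed and moves the end
    inside V. This is an equivalence relation, and its classes, projected to
    the groupoid, are the sheets over V. When V is path-connected every point
    of V is the end of a class in each sheet, and when every loop in V is
    contractible in the whole space that class is unique: the track of the end
    point is then a loop, whose contraction turns the link into a homotopy
    relative to both ends. So p maps each sheet bijectively onto V, and the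
    topology is all that remains.

    - A sheet is open in the quotient topology because being linked to a path
      is a neighbourhood of it in the compact-open topology
      ([near_linked]): walk along the path, and compare it with a nearby path
      on ever longer initial segments.
    - The inverse of p on a sheet is continuous ([sheet_section_continuous])
      because every compact-open neighbourhood of a path b contains all the
      paths that follow b up to a late time and stay close to b(1) afterwards
      ([nbhs_tails]); these reach every point near b(1).

    For universality, let r : Y -> X be a covering with Y nonempty. The end of
    the lift of a path depends continuously on the path for the compact-open
    topology ([lift_end_continuous]). Invariance under path homotopy follows
    without a separate homotopy lifting theorem: a homotopy is a continuous
    curve of paths, so the ends of the lifts form a continuous curve in one
    fibre, which is constant by uniqueness of lifts ([lift_end_homotopic]).
    Hence the end of the lift is a continuous function on the quotient.

    Everything that propagates along a path (existence and uniqueness of lifts,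
    the two continuity arguments) is an instance of one induction principle on
    the unit interval, [unit_interval_ind], which replaces subdivisions. *)

Set Implicit Arguments.
Unset Strict Implicit.
Unset Printing Implicit Defensive.

Import Order.TTheory GRing.Theory Num.Theory.
Import numFieldNormedType.Exports.

Local Open Scope classical_set_scope.
Local Open Scope ring_scope.
Local Open Scope quotient_scope.

(** * The unit interval *)

Section continuity.
Variable R : realType.
Local Notation I := (unitI R).

Lemma pasting (Z X : topologicalType) (h : Z -> R) (f g : Z -> X) (c : R) :
  continuous h -> continuous f -> continuous g ->
  (forall z, h z = c -> f z = g z) ->
  continuous (fun z => if h z <= c then f z else g z).
Proof.
move=> ch cf cg fg; set k := (X in continuous X).
pose A := [set z | h z <= c]; pose B := [set z | c <= h z].
have kA z : A z -> k z = f z by rewrite /k /A /= => ->.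
have kB z : B z -> k z = g z.
  rewrite /k /B /= le_eqVlt => /predU1P[zc|zc].
    by rewrite -zc lexx fg.
  by rewrite leNgt zc.
have AB : A `|` B = setT.
  by apply/seteqP; split => // z _; case: (leP (h z) c) => hz; [left|right; exact: ltW].
apply/continuous_subspace_setT; rewrite -AB; apply: withinU_continuous.
- by apply: (@closed_comp _ _ h [set x | x <= c]) => //; exact: closed_le.
- by apply: (@closed_comp _ _ h [set x | c <= x]) => //; exact: closed_ge.
- apply: (subspace_eq_continuous (f := f : subspace A -> X)).
    by move=> z /set_mem Az; exact/esym/kA.
  exact: continuous_subspaceT.
- apply: (subspace_eq_continuous (f := g : subspace B -> X)).
    by move=> z /set_mem Bz; exact/esym/kB.
  exact: continuous_subspaceT.
Qed.

Lemma continuous_pair (Z S T : topologicalType) (f : Z -> S) (g : Z -> T) :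
  continuous f -> continuous g -> continuous (fun z => (f z, g z)).
Proof.
move=> cf cg z.
exact: (@cvg_pair _ _ _ (nbhs z) (nbhs (f z)) (nbhs (g z)) _ _ _ f g (cf z) (cg z)).
Qed.

Lemma continuous_slice (S T X : topologicalType) (H : S * T -> X) (t : T) :
  continuous H -> continuous (fun s => H (s, t)).
Proof.
move=> cH s; apply: (@continuous_comp _ _ _ (fun s => (s, t)) H); last exact: cH.
by apply: continuous_pair => ?; [exact: cvg_id|exact: cvg_cst].
Qed.

Lemma continuous_clamp (Z X : topologicalType) (f : I -> X) (h : Z -> R) :
  continuous f -> continuous h -> continuous (fun z => f (clampI (h z))).
Proof.
move=> cf ch z; apply: (@continuous_comp _ _ _ h (fun x => f (clampI x))).
  exact: ch.
by apply: continuous_comp; [exact: clampI_continuous|exact: cf].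
Qed.

Lemma continuous_clamp2 (Z X : topologicalType) (F : I * I -> X) (h k : Z -> R) :
  continuous F -> continuous h -> continuous k ->
  continuous (fun z => F (clampI (h z), clampI (k z))).
Proof.
move=> cF ch ck z.
apply: (@continuous_comp _ _ _ (fun z => (clampI (h z), clampI (k z))) F).
  apply: continuous_pair; apply: (@continuous_clamp _ _ id) => // ?; exact: cvg_id.
exact: cF.
Qed.

Lemma continuous_val_fst : continuous (fun p : I * I => unitI_val p.1).
Proof.
move=> p; apply: (@continuous_comp _ _ _ fst); first exact: cvg_fst.
exact: unitI_val_continuous.
Qed.

Lemma continuous_val_snd : continuous (fun p : I * I => unitI_val p.2).
Proof.
move=> p; apply: (@continuous_comp _ _ _ snd); first exact: cvg_snd.
exact: unitI_val_continuous.
Qed.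

(** The supremum of the points where P holds is approached by such points from
    below; the local step at the supremum carries P beyond it, unless it is 1. *)
Lemma unit_interval_ind (P : R -> Prop) :
  P 0 ->
  (forall t, 0 <= t <= 1 -> exists2 e, 0 < e & forall t1 t2,
     0 <= t1 -> t1 <= t2 -> t2 <= 1 -> `|t1 - t| < e -> `|t2 - t| < e ->
     P t1 -> P t2) ->
  P 1.
Proof.
move=> P0 Ploc; pose S := [set t | 0 <= t <= 1 /\ P t].
have S0 : S 0 by split=> //; rewrite lexx ler01.
have supS : has_sup S by split; [exists 0|exists 1 => t [/andP[]]].
have Ssup t : S t -> t <= sup S by apply: ub_le_sup; case: supS.
have sup01 : 0 <= sup S <= 1.
  by rewrite (Ssup _ S0)/=; apply: ge_sup => [|t [/andP[]]//]; exists 0.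
have [e e0 eP] := Ploc _ sup01.
have [t1 [/andP[t10 t11] Pt1] t1S] := sup_adherent e0 supS.
have t1s : t1 <= sup S by apply: Ssup; split=> //; rewrite t10.
have P2 t2 : t1 <= t2 -> t2 <= 1 -> `|t2 - sup S| < e -> P t2.
  by move=> ? ? ?; apply: (eP t1) => //; rewrite ltr_distl; lra.
have [s1|s1] := leP 1 (sup S + e / 2).
  by apply: P2 => //; rewrite ltr_distl; lra.
have := Ssup (sup S + e / 2); suff Ss : S (sup S + e / 2) by move/(_ Ss); lra.
by split; [lra|apply: P2; rewrite ?ltr_distl; lra].
Qed.

End continuity.

(* Continuity of polynomial functions of the coordinates on the unit square. *)
Ltac contR := move=> ?; repeat first
  [ exact: cvg_cst | exact: continuous_val_fst | exact: continuous_val_snd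
  | exact: unitI_val_continuous | exact: cvg_id
  | apply: cvgD | apply: cvgN | apply: cvgM ].

(** * Homotopies that let the end point move in a set *)

Section linked.
Variables (R : realType) (X : topologicalType).
Local Notation I := (unitI R).
Implicit Types (a b c : I -> X) (U V : set X).

Definition linked V a b : Prop :=
  exists H : I * I -> X,
    [/\ continuous H,
        forall s, H (s, zero) = a s,
        forall s, H (s, one) = b s,
        forall t, H (zero, t) = a zero &
        forall t, V (H (one, t))].

Lemma linked_end V a b : linked V a b -> V (a one) /\ V (b one).
Proof. by case=> H [_ Ha Hb _ HV]; rewrite -Ha -Hb. Qed.

Lemma linkedS U V a b : U `<=` V -> linked U a b -> linked V a b.
Proof. by move=> UV [H [? ? ? ? HU]]; exists H; split=> // t; exact/UV. Qed.

Lemma path_homotopic_linked V a b : V (a one) -> path_homotopic a b -> linked V a b.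
Proof.
by move=> Va [H [cH Ha Hb Hr]]; exists H; split=> // t; have [h0 h1] := Hr t;
  rewrite ?h0 ?h1.
Qed.

Lemma linked_sym V a b : linked V a b -> linked V b a.
Proof.
case=> H [cH Ha Hb H0 HV].
exists (fun p => H (clampI (unitI_val p.1), clampI (1 - unitI_val p.2))); split.
- by apply: continuous_clamp2 => //; contR.
- by move=> s /=; rewrite clampI_val unitI_val0 subr0 clampI_ge1// Hb.
- by move=> s /=; rewrite clampI_val unitI_val1 subrr clampI_le0// Ha.
- by move=> t /=; rewrite clampI_val H0 -Hb H0.
- by move=> t /=; rewrite clampI_val.
Qed.

Lemma linked_trans V b a c : linked V a b -> linked V b c -> linked V a c.
Proof.
case=> F [cF Fa Fb F0 FV] [G [cG Gb Gc G0 GV]].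
pose x (p : I * I) := unitI_val p.1; pose y (p : I * I) := unitI_val p.2.
exists (fun p => if y p <= 2^-1 then F (clampI (x p), clampI (2 * y p))
                 else G (clampI (x p), clampI (2 * y p - 1))); split.
- apply: pasting; [by contR| | |].
  + by apply: continuous_clamp2 => //; contR.
  + by apply: continuous_clamp2 => //; contR.
  + move=> p yp; rewrite (@clampI_ge1 _ (2 * _)); last by lra.
    by rewrite (@clampI_le0 _ (2 * _ - 1)) ?Fb ?Gb//; lra.
- move=> s; rewrite /x /y /= clampI_val unitI_val0 mulr0 clampI_le0//.
  by rewrite invr_ge0 ler0n Fa.
- move=> s; rewrite /x /y /= clampI_val unitI_val1 leNgt invf_lt1 ?ltr0n// ltr1n/=.
  by rewrite clampI_ge1 ?Gc//; lra.
- move=> t; rewrite /x /= unitI_val0 clampI_le0// F0 G0.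
  by rewrite -Fb F0; case: ifP.
- by move=> t; rewrite /x /= unitI_val1 clampI_ge1//; case: ifP.
Qed.

Lemma linked_refl V a : continuous a -> V (a one) -> linked V a a.
Proof.
by move=> ca Va; apply: path_homotopic_linked => //; exact: path_homotopic_refl.
Qed.

(** The homotopy runs along the concatenation of a and g at a speed that grows
    from 1 to 2, so that its end point runs through g. *)
Lemma linked_extend V a (g : I -> X) :
  continuous a -> continuous g -> g zero = a one -> range g `<=` V ->
  exists b, [/\ continuous b, b one = g one & linked V a b].
Proof.
move=> ca cg ga gV.
pose h (p : I * I) := unitI_val p.1 * (1 + unitI_val p.2).
pose H p := if h p <= 1 then a (clampI (h p)) else g (clampI (h p - 1)).
have ch : continuous h by contR.
have cH : continuous H.
  apply: pasting => //; [exact: continuous_clamp| |].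
    by apply: continuous_clamp => // p; apply: cvgB; [exact: ch|exact: cvg_cst].
  by move=> p ->; rewrite subrr clampI_ge1// clampI_le0.
exists (fun s => H (s, one)); split.
- exact: continuous_slice.
- by rewrite /H /h /= unitI_val1 mul1r leNgt ltrDl ltr01 /= addrK clampI_ge1.
- exists H; split => //.
  + move=> s; rewrite /H /h /= unitI_val0 addr0 mulr1 clampI_val.
    by have /andP[_ ->] := unitI_val_itv s.
  + by move=> t; rewrite /H /h /= unitI_val0 mul0r ler01 clampI_le0.
  + move=> t; rewrite /H /h /= unitI_val1 mul1r; case: ifP => _.
      rewrite clampI_ge1; last by have /andP[? _] := unitI_val_itv t; lra.
      by rewrite -ga; apply: gV; exists zero.
    by apply: gV; eexists.
Qed.

(** The initial segment of a up to time t, parametrized by the whole interval. *)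
Definition truncate a (t : R) : I -> X := fun s => a (clampI (unitI_val s * t)).

Lemma truncate0 a : truncate a 0 = cst (a zero).
Proof. by apply/funext => s; rewrite /truncate mulr0 clampI_le0. Qed.

Lemma truncate1 a : truncate a 1 = a.
Proof. by apply/funext => s; rewrite /truncate mulr1 clampI_val. Qed.

Lemma truncate_one a t : truncate a t one = a (clampI t).
Proof. by rewrite /truncate unitI_val1 mul1r. Qed.

Lemma continuous_truncate a t : continuous a -> continuous (truncate a t).
Proof.
move=> ca; apply: continuous_clamp => // s.
by apply: continuousM; [exact: unitI_val_continuous|exact: cst_continuous].
Qed.

Lemma linked_truncate V a (t1 t2 : R) : continuous a -> t1 <= t2 ->
  (forall u, t1 <= u <= t2 -> V (a (clampI u))) ->
  linked V (truncate a t1) (truncate a t2).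
Proof.
move=> ca t12 aV.
exists (fun p => a (clampI (unitI_val p.1 * (t1 + unitI_val p.2 * (t2 - t1))))).
split.
- by apply: continuous_clamp => //; contR.
- by move=> s /=; rewrite unitI_val0 mul0r addr0.
- by move=> s /=; rewrite unitI_val1 mul1r subrKC.
- by move=> t /=; rewrite /truncate unitI_val0 !mul0r.
- move=> t /=; rewrite unitI_val1 mul1r; apply: aV.
  by have /andP[t0 t1'] := unitI_val_itv t; nra.
Qed.

(** [truncate a 2] runs through a at double speed and then waits at its end. *)
Lemma path_homotopic_double a : continuous a ->
  path_homotopic a (truncate a 2).
Proof.
move=> ca; exists (fun p => a (clampI (unitI_val p.1 * (1 + unitI_val p.2)))); split.
- by apply: continuous_clamp => //; contR.
- by move=> s /=; rewrite unitI_val0 addr0 mulr1 clampI_val.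
- by move=> s /=; rewrite unitI_val1.
- move=> t /=; rewrite unitI_val0 unitI_val1 mul0r mul1r clampI_le0//; split=> //.
  by rewrite clampI_ge1// lerDl; have /andP[] := unitI_val_itv t.
Qed.

(** The end point of the link describes a loop g in V. On the first half of the
    paths put the link, on the second half a contraction K of g: at parameter t
    the second half runs from g(t) to the base point of the loop. *)
Lemma linked_slsc V a b : slsc_subset R V -> continuous a -> continuous b ->
  a one = b one -> linked V a b -> path_homotopic a b.
Proof.
move=> slsc ca cb ab [H [cH Ha Hb H0 HV]].
pose g (t : I) := H (one, t).
have cg : continuous g by exact: (continuous_curry cH).2 one.
have g0 : g zero = a one by rewrite /g Ha.
have g1 : g one = a one by rewrite /g Hb -ab.
have [|K [cK K0 K1 Kr]] := slsc (a one) (mk_path cg g0 g1).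
  by move=> _ [t _ <-]; exact: HV.
have {}K0 s : K (s, zero) = g s by exact: K0.
have {}Kr t : K (zero, t) = a one /\ K (one, t) = a one.
  by have [-> ->] := Kr t; rewrite -[RHS]g0 -[X in _ /\ _ = X]g1.
suff ab2 : path_homotopic (truncate a 2) (truncate b 2).
  apply: (path_homotopic_trans (path_homotopic_double ca)).
  apply: (path_homotopic_trans ab2).
  exact/path_homotopic_sym/path_homotopic_double.
pose x (p : I * I) := unitI_val p.1; pose y (p : I * I) := unitI_val p.2.
exists (fun p => if x p <= 2^-1 then H (clampI (x p * 2), clampI (y p))
                 else K (clampI (y p), clampI (x p * 2 - 1))); split.
- apply: pasting; [by contR| | |].
  + by apply: continuous_clamp2 => //; contR.
  + by apply: continuous_clamp2 => //; contR.
  + move=> p xp; rewrite (@clampI_ge1 _ (_ * 2)); last by lra.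
    by rewrite (@clampI_le0 _ (_ * 2 - 1)) ?K0//; lra.
- move=> s; rewrite /x /y /= unitI_val0 (@clampI_le0 _ 0)// Ha /truncate.
  case: ifPn => //; rewrite -ltNge => s2.
  by rewrite (Kr _).1 clampI_ge1//; lra.
- move=> s; rewrite /x /y /= unitI_val1 (@clampI_ge1 _ 1)// Hb /truncate.
  case: ifPn => //; rewrite -ltNge => s2.
  by rewrite (Kr _).2 ab clampI_ge1//; lra.
- move=> t; rewrite /x /y /= unitI_val0 unitI_val1 !clampI_val mul0r.
  rewrite invr_ge0 ler0n clampI_le0// H0 truncate_one.
  rewrite /truncate unitI_val0 mul0r clampI_le0//; split=> //.
  by rewrite leNgt invf_lt1 ?ltr0n// ltr1n /= !clampI_ge1 ?K1//; lra.
Qed.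

End linked.

(** * The compact-open topology on based paths *)

Local Coercion based_path_fun : based_path >-> Funclass.

Section path_space.
Variables (R : realType) (X : topologicalType) (x0 : X).
Local Notation I := (unitI R).
Local Notation P := (based_path R x0).
Implicit Types a b : P.

Definition mk_based (f : I -> X) (cf : continuous f) (f0 : f zero = x0) : P :=
  exist _ (HB.pack_for (continuousType I X) f (isContinuous.Build _ _ f cf))
    (introT eqP f0).

Lemma mk_basedE f cf f0 : (@mk_based f cf f0 : I -> X) = f.
Proof. by []. Qed.

Lemma based_path_cts a : continuous a.
Proof. exact: cts_fun. Qed.

Lemma based_path0 a : a zero = x0.
Proof. exact/eqP/(valP a). Qed.

Lemma based_path_cvgP (F : set_system P) a : Filter F ->
  (forall K O, compact K -> open O -> a @` K `<=` O ->
     F [set b : P | b @` K `<=` O]) ->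
  F --> a.
Proof.
move=> FF FKO.
have cF : (@based_path_fun R X x0 @ F : set_system {compact-open, I -> X}) -->
    (a : {compact-open, I -> X}).
  by apply/compact_open_cvgP.
move=> A [B [[C oC <-] Ca CA]].
by apply: filterS CA _; apply: cF; exact: open_nbhs_nbhs.
Qed.

Lemma near_path_itv a (t1 t2 : R) (O : set X) : open O ->
  (forall u, t1 <= u <= t2 -> O (a (clampI u))) ->
  nbhs a [set b : P | forall u, t1 <= u <= t2 -> O (b (clampI u))].
Proof.
move=> oO aO; pose K : set I := @clampI R @` `[t1, t2].
have cK : compact K.
  apply: continuous_compact; last exact: segment_compact.
  by apply: continuous_subspaceT; exact: clampI_continuous.
have KE (f : I -> X) : (forall u, t1 <= u <= t2 -> O (f (clampI u))) <-> f @` K `<=` O.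
  split=> [fO _ [_ [u /= ut <-] <-]|fO u ut].
    by apply: fO; move: ut; rewrite in_itv.
  by apply: fO; exists (clampI u) => //; exists u => //=; rewrite in_itv.
have : nbhs a (@based_path_fun R X x0 @^-1`
    ([set g | g @` K `<=` O] : set {compact-open, I -> X})).
  apply: open_nbhs_nbhs; split; last exact/KE.
  by exists [set g | g @` K `<=` O] => //; exact: compact_open_open.
by apply: filterS => b /KE.
Qed.

Lemma near_path_at a (t : R) (O : set X) : open O -> O (a (clampI t)) ->
  nbhs a [set b : P | O (b (clampI t))].
Proof.
move=> oO Oa; have aO u : t <= u <= t -> O (a (clampI u)).
  by rewrite -eq_le => /eqP <-.
by have := near_path_itv oO aO; apply: filterS => b; apply; rewrite lexx.
Qed.

Lemma continuous_based_curry (Z : topologicalType) (h : Z -> P) :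
  continuous (fun p : Z * I => h p.1 p.2) -> continuous h.
Proof.
move=> ch z; apply: based_path_cvgP => K O cK oO hK.
have cc := continuous_curry_fun ch.
have /(cc z) : nbhs ((h z : I -> X) : {compact-open, I -> X})
    ([set g | g @` K `<=` O] : set {compact-open, I -> X}).
  by apply: open_nbhs_nbhs; split; [exact: compact_open_open|exact: hK].
exact.
Qed.

(** The paths that follow b up to a time 1 - e, for some e at most [eO.1], and
    remain in [eO.2] from then on. Such sets do not form a base of
    neighbourhoods of b, only of a filter that converges to b. *)
Definition tails b (eO : R * set X) : set P :=
  [set b' | exists e, [/\ 0 < e <= eO.1,
    forall u, u <= 1 - e -> b' (clampI u) = b (clampI u) &
    forall u, 1 - e <= u -> eO.2 (b' (clampI u))]].

Lemma nbhs_tails b (A : set P) : nbhs b A ->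
  exists eO : R * set X, [/\ 0 < eO.1, open_nbhs (b one) eO.2 &
    tails b eO `<=` A].
Proof.
pose D := [set eO : R * set X | 0 < eO.1 /\ open_nbhs (b one) eO.2].
suff : filter_from D (tails b) --> b.
  by move=> + /[dup] bA => /(_ _ bA)[eO [? ?] ?]; exists eO.
have FF : Filter (filter_from D (tails b)).
  apply: filter_from_filter.
    by exists (1, setT); split => //; split => //; exact: openT.
  move=> [e1 O1] [e2 O2] [/= e10 [oO1 bO1]] [/= e20 [oO2 bO2]].
  exists (Order.min e1 e2, O1 `&` O2).
    by split=> /=; [rewrite lt_min e10|split=> //; exact: openI].
  move=> b' [e [/=]]; rewrite le_min => /andP[e0 /andP[ee1 ee2]] b'b b'O.
  by split; exists e; split => //= [|u /b'O[]//]; apply/andP.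
apply: based_path_cvgP => K O cK oO bK.
(* If K contains 1, then O is itself a neighbourhood of b(1), and a path in the
   tail set takes its values on K among those of b on K or in O. *)
have [K1|K1] := pselect (K one).
  exists (1, O); first by split=> //; split=> //; apply: bK; exists one.
  move=> b' [e [_ b'b b'O]] _ [t Kt <-].
  have [te|te] := leP (unitI_val t) (1 - e).
    by rewrite -(clampI_val t) b'b// clampI_val; apply: bK; exists t.
  by rewrite -(clampI_val t); apply/b'O/ltW.
(* Otherwise the compact set K avoids a neighbourhood of 1, and paths that follow
   b long enough agree with b on K. *)
have cvK : closed (@unitI_val R @` K).
  apply: compact_closed; first exact: Rhausdorff.
  apply: continuous_compact => //; apply: continuous_subspaceT.
  exact: unitI_val_continuous.
have /closed_openC := cvK; rewrite openE => /(_ 1) [].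
  by move=> [t Kt t1]; apply: K1; rewrite -[one]clampI_val unitI_val1 -t1 clampI_val.
move=> e /= e0 eK; exists (e, setT); first by split=> //; split=> //; exact: openT.
move=> b' [e' [/= /andP[e'0 ee'] b'b _]] _ [t Kt <-].
rewrite -(clampI_val t) b'b; first by rewrite clampI_val; apply: bK; exists t.
rewrite leNgt; apply/negP => te; apply: (eK (unitI_val t)); last by exists t.
by have /andP[_ t1] := unitI_val_itv t; rewrite /ball/= ltr_distl; lra.
Qed.

End path_space.

(** * Sheets of the fundamental groupoid *)

Section sheets.
Variables (R : realType) (X : topologicalType) (x0 : X).
Local Notation I := (unitI R).
Local Notation P := (based_path R x0).
Local Notation Pi := (fundamental_groupoid R x0).
Implicit Types (a b : P) (U V : set X).
Hypothesis X_lpc : locally_path_connected R X.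

(** Induction on t, for the truncations of a at t and for all U at once. Near a
    given time a stays in a set W whose loops contract. The truncations at t1
    are linked in W, hence so are those at t2, since a nearby path b stays in W
    between the two times. Extending the truncation of a at t2 by a path inside
    both W and U that ends at b(t2) gives a path c linked to that truncation in
    U, and linked in W to the truncation of b, with which it shares its end; so
    these last two paths are homotopic. *)
Lemma near_linked a U : semilocally_simply_connected R X -> open U ->
  U (a one) -> nbhs a [set b : P | linked U a b].
Proof.
move=> X_slsc oU aU.
suff : forall U, open U -> U (a (clampI 1)) ->
    nbhs a [set b : P | linked U (truncate a 1) (truncate b 1)].
  move=> /(_ U oU); rewrite truncate1 clampI_ge1// => /(_ aU).
  by apply: filterS => b; rewrite /= truncate1.
move: U oU aU => _ _ _.
pose Q t := forall U, open U -> U (a (clampI t)) ->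
    nbhs a [set b : P | linked U (truncate a t) (truncate b t)].
apply: (unit_interval_ind (P := Q)) => [U _|t _].
  rewrite clampI_le0// based_path0 => Ux0; apply: (@filterE _ (nbhs a)) => b.
  rewrite /= !truncate0 !based_path0.
  by apply: linked_refl => //; exact: cst_continuous.
have [W [oW Wa slscW]] := X_slsc (a (clampI t)).
have : nbhs t (fun u => W (a (clampI u))).
  apply: (continuous_clamp (@based_path_cts _ _ _ a) (fun _ => cvg_id)).
  exact: open_nbhs_nbhs.
move=> [e e0 eW]; exists e => // t1 t2 t10 t12 t21 t1e t2e Qt1 U oU aU.
have aW u : t1 <= u <= t2 -> W (a (clampI u)).
  move=> ut; apply: eW; rewrite /ball/= distrC ltr_distl.
  by move: t1e t2e; rewrite !ltr_distl; lra.
have [V [oV Va VWU Vpc]] : exists V, [/\ open V, V (a (clampI t2)),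
    V `<=` W `&` U & path_connected R V].
  apply: X_lpc; apply: open_nbhs_nbhs; split; first exact: openI.
  by split=> //; apply: aW; rewrite t12 lexx.
have aWt1 : W (a (clampI t1)) by apply: aW; rewrite lexx.
have Qb := Qt1 W oW aWt1; have bW := near_path_itv oW aW; have bV := near_path_at oV Va.
have FF : Filter (nbhs a) by exact: nbhs_filter.
apply: (@filterS3 _ _ FF _ _ _ _ _ Qb bW bV) => b ab1 {}bW {}bV.
have abW : linked W (truncate a t2) (truncate b t2).
  apply: linked_trans (linked_truncate (@based_path_cts _ _ _ b) t12 bW).
  apply: linked_trans ab1; apply: linked_sym.
  exact: (linked_truncate (@based_path_cts _ _ _ a) t12 aW).
have ca2 : continuous (truncate a t2).
  by apply: continuous_truncate; exact: based_path_cts.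
have cb2 : continuous (truncate b t2).
  by apply: continuous_truncate; exact: based_path_cts.
have [g gV] := Vpc _ _ Va bV.
have [|c [cc c1 ac]] := linked_extend ca2 (@cts_fun _ _ g) _ gV.
  by rewrite truncate_one; exact: (@path_zero _ _ _ _ g).
have {}c1 : c one = b (clampI t2) by rewrite c1; exact: (@path_one _ _ _ _ g).
apply: (linked_trans (b := c)); first by apply: linkedS ac => x /VWU[].
have [_ Vc] := linked_end ac.
apply: path_homotopic_linked; first by have [] := VWU _ Vc.
apply: (linked_slsc slscW) => //; first by rewrite c1 truncate_one.
by apply: linked_trans abW; apply/linked_sym; apply: linkedS ac => x /VWU[].
Qed.

Definition sheet V a : set Pi :=
  [set c : Pi | linked V a (repr c : P)].

Lemma sheet_pi V a b :
  sheet V a (\pi_Pi b) <-> linked V a b.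
Proof.
have h : path_homotopic (repr (\pi_Pi b)) b.
  by apply/pi_eqP; rewrite reprK.
split=> ab; apply: (linked_trans ab); apply: path_homotopic_linked.
- by have [] := linked_end ab.
- exact: h.
- by have [] := linked_end ab.
- exact: path_homotopic_sym.
Qed.

Lemma sheet_open V a : semilocally_simply_connected R X -> open V -> open (sheet V a).
Proof.
move=> X_slsc oV; rewrite /open/= /quotient_open openE => b /= /sheet_pi ab.
have [_ Vb] := linked_end ab.
rewrite /interior; apply: filterS (near_linked X_slsc oV Vb) => b' bb'.
by apply/sheet_pi; exact: linked_trans bb'.
Qed.

Lemma sheet_inj V a c c' : slsc_subset R V -> sheet V a c -> sheet V a c' ->
  endpoint c = endpoint c' -> c = c'.
Proof.
move=> slscV ac ac' cc'; rewrite -[c]reprK -[c']reprK; apply/pi_eqP.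
apply: (linked_slsc slscV) => //; [exact: based_path_cts|exact: based_path_cts|].
exact: linked_trans (linked_sym ac) ac'.
Qed.

Lemma sheet_surj V a y : path_connected R V -> V (a one) -> V y ->
  exists2 c, sheet V a c & endpoint c = y.
Proof.
move=> Vpc Va Vy; have [g gV] := Vpc _ _ Va Vy.
have [|b [cb b1 ab]] := linked_extend (@based_path_cts _ _ _ a) (@cts_fun _ _ g) _ gV.
  exact: (@path_zero _ _ _ _ g).
have b0 : b zero = x0.
  case: (ab) => H [_ _ Hb H0 _]; rewrite -Hb H0; exact: based_path0.
exists (\pi_Pi (mk_based cb b0)); first exact/sheet_pi.
by rewrite endpoint_pi mk_basedE b1; exact: (@path_one _ _ _ _ g).
Qed.

(** Near y the section is computed explicitly: s(y') is the class of the path b'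
    that leaves a representative b of s(y) at a late time 1 - e and goes to y'
    inside a small V'. Up to that time b and b' agree, and afterwards both stay
    in V', so they are linked in V'. *)
Lemma sheet_section_continuous V a (s : X -> Pi) :
  open V -> slsc_subset R V ->
  (forall y, V y -> sheet V a (s y) /\ endpoint (s y) = y) ->
  forall y, V y -> {for y, continuous s}.
Proof.
move=> oV slscV sP y Vy W; rewrite nbhsE => -[W' [oW' W's] W'W].
have [] := sP y Vy; rewrite -[s y]reprK; set b : P := repr (s y).
move=> /sheet_pi ab; rewrite endpoint_pi => by1.
have : nbhs b (\pi_Pi @^-1` W').
  by apply: open_nbhs_nbhs; split => //; rewrite /= /b reprK.
move=> /nbhs_tails [[e0 O] [/= e00 [oO bO] OW']].
have [V' [oV' V'y V'OV V'pc]] : exists V', [/\ open V', V' y, V' `<=` O `&` V &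
    path_connected R V'].
  apply: X_lpc; apply: open_nbhs_nbhs; split; first exact: openI.
  by split=> //; rewrite -by1.
have : nbhs (1 : R) (fun u => V' (b (clampI u))).
  apply: (continuous_clamp (@based_path_cts _ _ _ b) (fun _ => cvg_id)).
  by apply: open_nbhs_nbhs; split=> //; rewrite clampI_ge1// by1.
move=> [e1 /= e10 e1V'].
(* e <= 2^-1 keeps the start of b' at x0; e <= e1 / 2 keeps b in V' from time
   1 - e on. *)
pose e := Order.min e0 (Order.min (e1 / 2) 2^-1).
have ee0 : 0 < e by rewrite !lt_min e00 invr_gt0 ltr0n andbT divr_gt0.
have [ele0 ele1 ele2] : [/\ e <= e0, e <= e1 / 2 & e <= 2^-1].
  by rewrite /e !ge_min !lexx ?orbT.
have bV' u : 1 - e <= u -> V' (b (clampI u)).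
  move=> ue; have [u1|u1] := leP 1 u; first by rewrite clampI_ge1// by1.
  by apply: e1V'; rewrite /ball/= ltr_distl; lra.
have bbe : linked V' (truncate b (1 - e)) b.
  rewrite -[X in linked _ _ X]truncate1.
  apply: linked_truncate; [exact: based_path_cts|lra|].
  by move=> u /andP[? _]; exact: bV'.
apply: filterS (open_nbhs_nbhs (conj oV' V'y)) => y' V'y'; apply: W'W.
have [g gV'] := V'pc _ _ (bV' _ (lexx _)) V'y'.
pose f (t : I) := if unitI_val t <= 1 - e then b (clampI (unitI_val t))
  else g (clampI ((unitI_val t - (1 - e)) / e)).
have cf : continuous f.
  apply: pasting; [exact: unitI_val_continuous| | |].
  - by apply: continuous_clamp; [exact: based_path_cts|exact: unitI_val_continuous].
  - apply: continuous_clamp; [exact: cts_fun|] => t.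
    apply: (@continuousM _ _ (fun z : I => unitI_val z - (1 - e)) (cst e^-1)).
      by apply: continuousB; [exact: unitI_val_continuous|exact: cst_continuous].
    exact: cst_continuous.
  - by move=> t ->; rewrite subrr mul0r (@clampI_le0 _ 0)// path_zero.
have f0 : f zero = x0.
  by rewrite /f unitI_val0 ifT; [rewrite clampI_le0// based_path0|lra].
pose b' := mk_based cf f0.
have b'b u : u <= 1 - e -> b' (clampI u) = b (clampI u).
  move=> ue; rewrite mk_basedE /f clampI_val clampI_valE.
  by rewrite ifT// ge_max ge_min ue orbT andbT; lra.
have b'V' u : 1 - e <= u -> V' (b' (clampI u)).
  move=> ue; rewrite mk_basedE /f clampI_val; case: ifPn => [ue'|_]; last first.
    by apply: gV'; eexists.
  have -> : b (clampI u) = b (clampI (1 - e)).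
    congr (b _); apply: unitI_val_inj; apply/eqP.
    move: ue'; rewrite !clampI_valE ge_max ge_min => /andP[_ /orP[|ue']]; first lra.
    by have -> : u = 1 - e by lra.
  exact: bV'.
have b'1 : b' one = y'.
  rewrite mk_basedE /f unitI_val1 leNgt ltrBlDr ltrDl ee0 /=.
  by rewrite subKr divff ?gt_eqF// (@clampI_ge1 _ 1)//; exact: (@path_one _ _ _ _ g).
have bb' : linked V' b b'.
  apply: linked_trans (linked_sym bbe) _.
  rewrite -[X in linked _ _ X]truncate1.
  have -> : truncate b (1 - e) = truncate b' (1 - e).
    apply/funext => t; rewrite /truncate b'b//.
    have /andP[? ?] := unitI_val_itv t; nra.
  by apply: linked_truncate; [exact: based_path_cts|lra|move=> u /andP[? _]; exact: b'V'].
have -> : s y' = \pi_Pi b'.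
  have [sy' sy'1] := sP y' (V'OV _ V'y').2.
  apply: (sheet_inj slscV sy'); last by rewrite sy'1 endpoint_pi.
  by apply/sheet_pi; apply: linked_trans ab _; apply: linkedS bb' => x /V'OV[].
apply: OW'; exists e; split; [by rewrite ee0|exact: b'b|].
by move=> u /b'V' /V'OV[].
Qed.

End sheets.

(** * Coverings and their lifts *)

Lemma evenly_covered_sections (E X : topologicalType) (p : E -> X) (U : set X)
    (F : set (set E)) : continuous p ->
  (forall V, F V -> open V) -> trivIset F id -> p @^-1` U = \bigcup_(V in F) V ->
  (forall V, F V -> exists s : X -> E,
     (forall x, U x -> [/\ V (s x), p (s x) = x & {for x, continuous s}]) /\
     (forall v, V v -> s (p v) = v)) ->
  evenly_covered p U.
Proof.
move=> cp oF tF pU Fs; exists F; split => // V FV.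
have [s [sU sp]] := Fs V FV.
have VU v : V v -> U (p v) by move=> Vv; rewrite -[U (p v)]/((p @^-1` U) v) pU; exists V.
pose f (v : V) : U := exist _ (p (set_val v)) (mem_set (VU _ (set_valP v))).
pose g (x : U) : V := exist _ (s (set_val x))
  (mem_set (let: And3 h _ _ := sU _ (set_valP x) in h)).
exists f => //; split.
  apply/continuousP => _ [A oA <-]; exists (p @^-1` A) => //.
  by move/continuousP: cp; exact.
exists g; split.
- move=> x W [_ [[A oA <-] Ax AW]].
  have [_ _ cs] := sU _ (set_valP x).
  have : nbhs (set_val x) (s @^-1` A) by apply: cs; exact: open_nbhs_nbhs.
  rewrite nbhsE => -[N [oN Nx] NA].
  exists (set_val @^-1` N); split => //; first by exists N.
  by move=> x' /= Nx'; apply: AW; exact: NA.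
- by move=> v; apply: val_inj; rewrite /= sp//; exact: set_valP.
- by move=> x; apply: val_inj; have [] := sU _ (set_valP x).
Qed.

Section coverings.
Variables (Y X : topologicalType) (r : Y -> X).

(** The closed set D records that a sheet is clopen in the preimage of U, because
    its complement there is the union of the other sheets. *)
Lemma sheet_through U y : evenly_covered r U -> U (r y) ->
  exists (V : set Y) (s : X -> Y), [/\ open V, V y,
    exists2 D, closed D & V = r @^-1` U `&` D,
    forall v, V v -> s (r v) = v &
    forall x, open U -> U x -> [/\ r (s x) = x & {for x, continuous s}]].
Proof.
move=> [F [oF tF rU Fh]] Uy.
have : (r @^-1` U) y by [].
rewrite {1}rU => -[V FV Vy].
have [f [cf [g [cg fK gK]]] fr] := Fh V FV.
pose s x := if pselect (U x) is left h then set_val (g (exist _ x (mem_set h))) else y.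
have sE (x : U) : s (set_val x) = set_val (g x).
  rewrite /s; case: pselect => [h|]; last by case; exact: set_valP.
  by congr (set_val (g _)); exact: val_inj.
exists V, s; split => //; first exact: oF.
- exists (~` \bigcup_(W in F `\ V) W).
    by apply: open_closedC; apply: bigcup_open => W [FW _]; exact: oF.
  rewrite rU; apply/seteqP; split => [v Vv|v [[W FW Wv] vF]].
    split; first by exists V.
    by move=> [W [FW /= WV] Wv]; apply: WV; apply: tF => //; exists v.
  have [<-//|WV] := pselect (W = V).
  by exfalso; apply: vF; exists W.
- move=> v Vv.
  have := fr (exist _ v (mem_set Vv)) => /= <-.
  by rewrite sE fK.
- move=> x oU Ux; pose x' : U := exist _ x (mem_set Ux); split.
    by rewrite -[x]/(set_val x') sE -fr gK.
  move=> W; rewrite -[x]/(set_val x') sE nbhsE => -[W' [oW' W'g] W'W].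
  have : nbhs x' (g @^-1` (set_val @^-1` W')).
    by apply: cg; apply: open_nbhs_nbhs; split => //; exists W'.
  move=> [_ [[A oA <-] Ax AW]].
  apply: filterS (open_nbhs_nbhs (conj (openI oA oU) (conj Ax Ux))).
  move=> z [Az Uz]; apply: W'W; rewrite -[z]/(set_val (exist _ z (mem_set Uz) : U)) sE.
  exact: AW.
Qed.

Variable R : realType.

(** The image of the interval under c is connected and V is clopen in the preimage
    of U. *)
Lemma stay_in_sheet (U : set X) (V : set Y) (c : R -> Y) (t1 t2 : R) :
  continuous c -> open V -> (exists2 D, closed D & V = r @^-1` U `&` D) ->
  (forall u, t1 <= u <= t2 -> U (r (c u))) -> V (c t1) ->
  forall u, t1 <= u <= t2 -> V (c u).
Proof.
move=> cc oV [D cD VD] cU Vt1 u /andP[t1u ut2].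
pose A := c @` `[t1, t2].
have cA : connected A.
  apply: connected_continuous_connected; first exact: segment_connected.
  exact: continuous_subspaceT.
have mA t : t1 <= t <= t2 -> A (c t) by exists t => //=; rewrite in_itv.
have AV : A `&` V = A.
  apply: cA.
  - by exists (c t1); split => //; apply: mA; rewrite lexx (le_trans t1u).
  - by exists V.
  - exists D => //; rewrite VD setIA; congr (_ `&` _); apply/setIidPl.
    by move=> _ [t tt <-]; apply: cU; move: tt; rewrite /= in_itv.
by have : A (c u) by [apply: mA; rewrite t1u]; rewrite -AV => -[].
Qed.

Hypothesis r_cov : covering r.

Lemma covering_near (f : R -> X) (t : R) : continuous f ->
  exists U : set X, [/\ open U, evenly_covered r U &
    exists2 e, 0 < e & forall u, `|u - t| < e -> U (f u)].
Proof.
move=> cf; have [_ /(_ (f t)) [U [oU Uf eU]]] := r_cov; exists U; split => //.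
have : nbhs t (f @^-1` U) by apply: cf; exact: open_nbhs_nbhs.
by move=> [e e0 eU']; exists e => // u ut; apply: eU'; rewrite /ball/= distrC.
Qed.

Lemma lift_exists (f : R -> X) (y0 : Y) : continuous f -> r y0 = f 0 ->
  exists c : R -> Y, [/\ continuous c, c 0 = y0 & forall u, 0 <= u <= 1 -> r (c u) = f u].
Proof.
move=> cf y0f.
pose Q t := exists c : R -> Y, [/\ continuous c, c 0 = y0 &
  forall u, 0 <= u <= t -> r (c u) = f u].
apply: (unit_interval_ind (P := Q)).
  exists (cst y0); split => //; first by move=> ?; exact: cst_continuous.
  by move=> u; rewrite -eq_le => /eqP <-.
move=> t _; have [U [oU eU [e e0 Uf]]] := covering_near t cf.
exists e => // t1 t2 t10 t12 _ t1e t2e [c [cc c0 rc]].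
have rct1 : r (c t1) = f t1 by apply: rc; rewrite t10 lexx.
have Uc : U (r (c t1)) by rewrite rct1; exact: Uf.
have [V [s [oV Vc _ sr sU]]] := sheet_through eU Uc.
(* Clamping u to [t1, t2], where f stays in U, makes the second branch continuous
   on the whole line. *)
pose m u := Order.max t1 (Order.min t2 u).
have cm : continuous m.
  move=> u; apply: (@continuous_max _ _ (cst t1)); first exact: cst_continuous.
  by apply: (@continuous_min _ _ (cst t2) id); [exact: cst_continuous|].
have Um u : U (f (m u)).
  apply: Uf; move: t1e t2e; rewrite /m !ltr_distl.
  by rewrite lt_max gt_max lt_min gt_min; lra.
exists (fun u => if u <= t1 then c u else s (f (m u))); split.
- apply: (@pasting R R Y id) => //; [by move=> ?; exact: cvg_id| |].
    move=> u; have [_ cs] := sU _ oU (Um u).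
    have cfm : {for u, continuous (f \o m)}.
      by apply: continuous_comp; [exact: cm|exact: cf].
    exact: (continuous_comp cfm cs).
  by move=> u ->; rewrite /m min_r// max_l// -rct1 sr.
- by rewrite t10.
- move=> u /andP[u0 ut2]; have [ut1|ut1] := leP u t1; first by apply: rc; rewrite u0.
  by have [-> _] := sU _ oU (Um u); rewrite /m min_r// max_r// ltW.
Qed.

Lemma lift_unique (c d : R -> Y) : continuous c -> continuous d -> c 0 = d 0 ->
  (forall u, 0 <= u <= 1 -> r (c u) = r (d u)) -> c 1 = d 1.
Proof.
move=> cc cd cd0 rcd; apply: (unit_interval_ind (P := fun t => c t = d t)) => // t _.
have crc : continuous (r \o c).
  by move=> u; apply: continuous_comp; [exact: cc|exact: r_cov.1].
have [U [oU eU [e e0 Uc]]] := covering_near t crc.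
exists e => // t1 t2 t10 t12 t21 t1e t2e cd1.
have Urc u : t1 <= u <= t2 -> U (r (c u)).
  by move=> ut; apply: Uc; move: t1e t2e; rewrite !ltr_distl; lra.
have Urd u : t1 <= u <= t2 -> U (r (d u)).
  by move=> ut; rewrite -rcd; [exact: Urc|lra].
have [|V [s [oV Vc VD sr _]]] := @sheet_through U (c t1) eU.
  by apply: Urc; rewrite lexx.
have Vd : V (d t1) by rewrite -cd1.
have t2t : t1 <= t2 <= t2 by rewrite t12 lexx.
rewrite -(sr _ (stay_in_sheet cc oV VD Urc Vc t2t)).
rewrite -(sr _ (stay_in_sheet cd oV VD Urd Vd t2t)).
by rewrite rcd//; lra.
Qed.

Section lift_end.
Variables (x0 : X) (y0 : Y) (y0x0 : r y0 = x0).
Local Notation I := (unitI R).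
Local Notation P := (based_path R x0).

(** [L a] is a lift of a; its values outside the unit interval are arbitrary. *)
Definition path_lifting (L : P -> R -> Y) : Prop :=
  forall a, [/\ continuous (L a), L a 0 = y0 &
    forall u, 0 <= u <= 1 -> r (L a u) = a (clampI u)].

Lemma path_lifting_exists : exists L, path_lifting L.
Proof.
suff /choice[L LP] : forall a : P, exists c : R -> Y, [/\ continuous c, c 0 = y0 &
  forall u, 0 <= u <= 1 -> r (c u) = a (clampI u)] by exists L.
move=> a; apply: lift_exists.
  by apply: continuous_clamp; [exact: based_path_cts|move=> ?; exact: cvg_id].
by rewrite y0x0 clampI_le0// based_path0.
Qed.

(** Induction on t for the continuity of b |-> L b t at a. Between t1 and t2 the
    paths near a stay in one evenly covered set, and their lifts stay in the
    sheet V that contains [L a t1]; so at t2 the lift of b is the image of b(t2)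
    under the section s of that sheet. *)
Lemma lift_end_continuous (L : P -> R -> Y) : path_lifting L ->
  continuous (fun a => L a 1).
Proof.
move=> LP; suff : forall a : P, L b 1 @[b --> a] --> L a 1 by [].
move=> a; pose Q t := (fun b => L b t) @ (a : P) --> L a t.
apply: (unit_interval_ind (P := Q)) => [|t _].
  rewrite /Q; have -> : (fun b => L b 0) = cst y0 by apply/funext => b; have [] := LP b.
  by have [_ -> _] := LP a; exact: (@cst_continuous P Y y0 a).
have ca : continuous (fun u => a (clampI u)).
  by apply: continuous_clamp; [exact: based_path_cts|move=> ?; exact: cvg_id].
have [U [oU eU [e e0 Ua]]] := covering_near t ca.
exists e => // t1 t2 t10 t12 t21 t1e t2e Qt1.
have rL (b : P) u : t1 <= u <= t2 -> r (L b u) = b (clampI u).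
  by move=> ut; have [_ _ ->//] := LP b; lra.
have Ua' u : t1 <= u <= t2 -> U (a (clampI u)).
  by move=> ut; apply: Ua; move: t1e t2e; rewrite !ltr_distl; lra.
have UL (b : P) : (forall u, t1 <= u <= t2 -> U (b (clampI u))) ->
    forall u, t1 <= u <= t2 -> U (r (L b u)).
  by move=> bU u ut; rewrite rL//; exact: bU.
have t1t : t1 <= t1 <= t2 by rewrite lexx.
have t2t : t1 <= t2 <= t2 by rewrite t12 lexx.
have [V [s [oV Va VD sr sU]]] := sheet_through eU (UL a Ua' _ t1t).
have L2 (b : P) : V (L b t1) -> (forall u, t1 <= u <= t2 -> U (b (clampI u))) ->
    L b t2 = s (b (clampI t2)).
  move=> Vb Ub; have [cb _ _] := LP b; rewrite -rL// sr//.
  exact: (stay_in_sheet cb oV VD (UL b Ub)).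
have nV : nbhs a [set b : P | V (L b t1)] by apply: Qt1; exact: open_nbhs_nbhs.
have nU := near_path_itv oU Ua'.
move=> W; rewrite L2// => Ws.
have [_ cs] := sU _ oU (Ua' _ t2t).
have := cs _ Ws; rewrite /= nbhsE => -[N [oN Na] NW].
have nO := near_path_at oN Na.
have FF : Filter (nbhs a) by exact: nbhs_filter.
apply: (@filterS3 _ _ FF _ _ _ _ _ nV nU nO) => b Vb Ub Ob.
by rewrite /= L2//; exact: NW.
Qed.

(** A homotopy is a curve h of based paths; the ends of the lifts of the h(u)
    form a curve that lifts a constant, hence is constant. *)
Lemma lift_end_homotopic (L : P -> R -> Y) : path_lifting L ->
  forall a b : P, path_homotopic a b -> L a 1 = L b 1.
Proof.
move=> LP a b [H [cH Ha Hb Hr]].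
pose G (p : R * I) := H (p.2, clampI p.1).
have cG : continuous G.
  move=> p; apply: (@continuous_comp _ _ _ (fun p : R * I => (p.2, clampI p.1)) H).
    apply: continuous_pair => q; first exact: cvg_snd.
    apply: (@continuous_comp _ _ _ fst (@clampI R)); first exact: cvg_fst.
    exact: clampI_continuous.
  exact: cH.
have G0 u : curry G u zero = x0 by rewrite /curry /G /= (Hr _).1 based_path0.
pose h u : P := mk_based ((continuous_curry cG).2 u) (G0 u).
have ch : continuous h.
  apply: continuous_based_curry.
  have -> // : (fun p : R * I => h p.1 p.2) = G by apply/funext => -[].
have Lfun (b1 b2 : P) : b1 =1 b2 -> L b1 1 = L b2 1.
  move=> b12; have [c1 L10 r1] := LP b1; have [c2 L20 r2] := LP b2.
  apply: lift_unique => //; first by rewrite L10.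
  by move=> u u01; rewrite r1// r2// b12.
have -> : L a 1 = L (h 0) 1.
  by apply: Lfun => s; rewrite mk_basedE /curry /G /= clampI_le0// Ha.
have -> : L b 1 = L (h 1) 1.
  by apply: Lfun => s; rewrite mk_basedE /curry /G /= clampI_ge1// Hb.
apply: (@lift_unique (cst (L (h 0) 1)) (fun u => L (h u) 1)) => //.
- by move=> ?; exact: cst_continuous.
- move=> u; apply: (@continuous_comp _ _ _ h (fun b => L b 1)); first exact: ch.
  exact: lift_end_continuous.
- have rL v : r (L (h v) 1) = a one.
    have [_ _ ->] := LP (h v); last by rewrite ler01 lexx.
    by rewrite clampI_ge1// mk_basedE /curry /G /= (Hr _).2.
  by move=> u _; rewrite /= !rL.
Qed.

End lift_end.
End coverings.

(** * The universal covering *)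

Section universal.
Variables (R : realType) (X : topologicalType) (x0 : X).
Local Notation P := (based_path R x0).
Local Notation Pi := (fundamental_groupoid R x0).

(** The truncations of a path a form a continuous curve from the constant path
    to a. *)
Lemma fundamental_groupoid_connected : connected_space Pi.
Proof.
have h0 (a : P) t : truncate a t zero = x0.
  by rewrite /truncate unitI_val0 mul0r clampI_le0// based_path0.
pose h (a : P) t : P :=
  mk_based (continuous_truncate (t := t) (@based_path_cts _ _ _ a)) (h0 a t).
have ch a : continuous (h a).
  apply: continuous_based_curry => /=.
  apply: (@continuous_clamp _ _ _ a (fun p : R * unitI R => unitI_val p.2 * p.1)).
    exact: based_path_cts.
  move=> p; apply: (@continuousM _ _ (fun p : R * unitI R => unitI_val p.2) fst);
    last exact: cvg_fst.
  by apply: (@continuous_comp _ _ _ snd); [exact: cvg_snd|exact: unitI_val_continuous].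
have hcst : continuous (cst x0 : unitI R -> X) by move=> ?; exact: cst_continuous.
pose c0 : Pi := \pi_Pi (mk_based hcst erefl).
split; first by exists c0.
have -> : [set: Pi] = \bigcup_(a in [set: P]) ((fun t => \pi_Pi (h a t)) @` `[0, 1]).
  apply/seteqP; split=> // c _; exists (repr c) => //; exists 1 => /=.
    by rewrite in_itv/= ler01 lexx.
  rewrite -[RHS]reprK; apply/pi_eqP; rewrite mk_basedE truncate1.
  exact/path_homotopic_refl/based_path_cts.
apply: bigcup_connected.
  exists c0 => a _; exists 0; first by rewrite /= in_itv/= ler01 lexx.
  apply/pi_eqP; rewrite !mk_basedE truncate0 based_path0.
  exact: path_homotopic_refl.
move=> a _; apply: connected_continuous_connected; first exact: segment_connected.
apply: continuous_subspaceT => t; apply: continuous_comp; first exact: ch.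
exact: pi_continuous.
Qed.

Lemma endpoint_continuous : continuous (@endpoint R X x0).
Proof.
apply/continuousP => A oA; rewrite /open/= /quotient_open openE => a Aa.
have {}Aa : A ((a : P) (clampI 1)).
  by rewrite clampI_ge1//; move: Aa; rewrite /= endpoint_pi.
have := near_path_at oA Aa; apply: filterS => b /=.
by rewrite clampI_ge1// endpoint_pi.
Qed.

Lemma endpoint_covering : locally_path_connected R X ->
  semilocally_simply_connected R X -> covering (@endpoint R X x0).
Proof.
move=> X_lpc X_slsc; split; first exact: endpoint_continuous.
move=> x; have [U [oU Ux slscU]] := X_slsc x.
have [V [oV Vx VU Vpc]] := X_lpc _ _ (open_nbhs_nbhs (conj oU Ux)).
have slscV : slsc_subset R V.
  by move=> y g gV; apply: slscU; exact: subset_trans VU.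
exists V; split => //.
apply: (@evenly_covered_sections _ _ _ _
  [set S | exists a : P, V (a one) /\ S = sheet V a]).
- exact: endpoint_continuous.
- by move=> _ [a [Va ->]]; exact: sheet_open.
- move=> _ _ [a [Va ->]] [b [Vb ->]] [c [ac bc]].
  have ab := linked_trans ac (linked_sym bc).
  apply/seteqP; split=> d; first exact: linked_trans (linked_sym ab).
  exact: linked_trans ab.
- apply/seteqP; split=> [c Vc|c [_ [a [_ ->]] ac]].
    exists (sheet V (repr c)); first by exists (repr c).
    by apply: linked_refl => //; exact: based_path_cts.
  by have [] := linked_end ac.
- move=> _ [a [Va ->]].
  have [s sP] : exists s : X -> Pi,
      forall y, V y -> sheet V a (s y) /\ endpoint (s y) = y.
    suff /choice[s sP] : forall y, exists c : Pi,
      V y -> sheet V a c /\ endpoint c = y by exists s.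
    move=> y; have [Vy|nVy] := pselect (V y); last by exists (\pi_Pi a).
    by have [c ac cy] := sheet_surj Vpc Va Vy; exists c.
  exists s; split => [y Vy|c ac].
    have [? ?] := sP y Vy; split => //.
    exact: (sheet_section_continuous X_lpc oV slscV sP Vy).
  have [_ Vc] := linked_end ac.
  by have [sc sc1] := sP (endpoint c) Vc; exact: (sheet_inj slscV sc ac).
Qed.

(** X being path-connected, Y has a point over x0; it serves as the start of all
    the lifts. *)
Lemma endpoint_factors (Y : topologicalType) (r : Y -> X) :
  path_connected R [set: X] -> [set: Y] !=set0 -> covering r ->
  exists f : Pi -> Y, continuous f /\ r \o f = @endpoint R X x0.
Proof.
move=> X_pc [y _] r_cov; have [g _] := X_pc (r y) x0 I I.
have [||c [_ c0 rc]] := lift_exists r_cov (f := fun u : R => g (clampI u)) (y0 := y).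
- by apply: continuous_clamp; [exact: cts_fun|move=> ?; exact: cvg_id].
- by rewrite clampI_le0//; exact/esym/(@path_zero _ _ _ _ g).
have c1 : r (c 1) = x0.
  by rewrite rc ?ler01 ?lexx// clampI_ge1//; exact: (@path_one _ _ _ _ g).
have [L LP] := path_lifting_exists R r_cov c1.
exists (fun e => L (repr e) 1); split.
  apply/quotient_continuous.
  have -> : (fun e : Pi => L (repr e) 1) \o \pi_Pi = (fun a => L a 1).
    apply/funext => a /=; apply: (lift_end_homotopic r_cov LP).
    by apply/pi_eqP; rewrite reprK.
  exact: (lift_end_continuous r_cov LP).
apply/funext => e /=; have [_ _ ->] := LP (repr e); last by rewrite ler01 lexx.
by rewrite clampI_ge1.
Qed.

End universal.

Theorem mainTheorem1 (R : realType) (X : topologicalType) (x0 : X)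
    (X_pc : path_connected R [set: X])
    (X_lpc : locally_path_connected R X)
    (X_slsc : semilocally_simply_connected R X) :
  universal_covering (@endpoint R X x0).
Proof.
split.
- exact: endpoint_covering.
- exact: fundamental_groupoid_connected.
- by move=> Y r [Y0 _]; exact: endpoint_factors.
Qed.
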